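(* Let $d,m\in\mathbb{N}$, and let $\Sigma$ and $\Omega$ be real symmetric positive definite matrices of sizes $d\times d$ and $m\times m$, respectively. Let $K_{\nu,\Sigma,\Omega}$ be the density of the centered matrix-variate $T$ distribution $T_{d,m}(\nu,\Sigma,\Omega)$ and $g_{\Sigma,\Omega}$ the density of the centered matrix-variate normal distribution $\mathrm{MN}_{d,m}(0_{d\times m},\Sigma\otimes\Omega)$ (both given in the context). For $X\in\mathbb{R}^{d\times m}$ put $$\Delta_X := \Sigma^{-1/2} X \Omega^{-1/2},\qquad \delta_{\lambda_j} := \sqrt{\tfrac{\nu-2}{\nu}\,\lambda_j(\Delta_X\Delta_X^{\top})},\quad 1\le j\le d,$$ where $\lambda_1(\cdot)\ge\dots\ge\lambda_d(\cdot)$ denote the eigenvalues. Pick any $\eta\in(0,1)$ and let $$B_{\nu,\Sigma,\Omega}(\eta) := \Big\{X\in\mathbb{R}^{d\times m} : \max_{1\le j\le d}\frac{\delta_{\lambda_j}}{\sqrt{\nu-2}}\le \eta\,\nu^{-1/4}\Big\}.$$ Then, as $\nu\to\infty$ and uniformly for $X\in B_{\nu,\Sigma,\Omega}(\eta)$, $$\begin{aligned} &\log\left(\frac{[\nu/(\nu-2)]^{md/2}\,K_{\nu,\Sigma,\Omega}(X)}{g_{\Sigma,\Omega}\big(X/\sqrt{\nu/(\nu-2)}\big)}\right)\\ &= \nu^{-1}\Big\{\tfrac14\mathrm{tr}\big((\Delta_X\Delta_X^{\top})^2\big)-\tfrac{m+d+1}{2}\mathrm{tr}\big(\Delta_X\Delta_X^{\top}\big)+\tfrac{md(m+d+1)}{4}\Big\}\\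 &\quad+\nu^{-2}\Big\{-\tfrac16\mathrm{tr}\big((\Delta_X\Delta_X^{\top})^3\big)+\tfrac{m+d-1}{4}\mathrm{tr}\big((\Delta_X\Delta_X^{\top})^2\big)+\tfrac{md}{24}\big(13-2d^2-3d(-3+m)+9m-2m^2\big)\Big\}\\ &\quad+\nu^{-3}\Big\{\tfrac18\mathrm{tr}\big((\Delta_X\Delta_X^{\top})^4\big)-\tfrac{m+d-1}{6}\mathrm{tr}\big((\Delta_X\Delta_X^{\top})^3\big)\\ &\qquad\qquad+\tfrac{md}{24}\big(26+d^3+2d^2(-3+m)+11m-6m^2+m^3+d(11-9m+2m^2)\big)\Big\}\\ &\quad+\mathcal{O}_{d,m,\eta}\left(\frac{1+\mathrm{tr}\big((\Delta_X\Delta_X^{\top})^5\big)}{\nu^4}\right). \end{aligned}$$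
   Context: $|\cdot|$ denotes the determinant and $\mathrm{tr}$ the trace; $\Sigma^{-1/2}$, $\Omega^{-1/2}$ are the inverses of the symmetric positive definite square roots. For $\nu>0$, the centered matrix-variate $T$ distribution $T_{d,m}(\nu,\Sigma,\Omega)$ has density, for $X\in\mathbb{R}^{d\times m}$, $$K_{\nu,\Sigma,\Omega}(X) := \frac{\Gamma_d(\frac12(\nu+m+d-1))}{\Gamma_d(\frac12(\nu+d-1))}\,\frac{|\mathrm{I}_d+\nu^{-1}\Sigma^{-1}X\Omega^{-1}X^{\top}|^{-(\nu+m+d-1)/2}}{(\nu\pi)^{md/2}|\Sigma|^{m/2}|\Omega|^{d/2}},$$ where $\Gamma_d(z)=\pi^{d(d-1)/4}\prod_{j=1}^d\Gamma\big(z-\frac{j-1}{2}\big)$, $\Re(z)>\frac{d-1}{2}$, is the multivariate gamma function and $\Gamma$ the classical gamma function. The $\mathrm{MN}_{d,m}(0_{d\times m},\Sigma\otimes\Omega)$ density is $$g_{\Sigma,\Omega}(X)=\frac{\exp\big(-\frac12\mathrm{tr}(\Sigma^{-1}X\Omega^{-1}X^{\top})\big)}{(2\pi)^{md/2}|\Sigma|^{m/2}|\Omega|^{d/2}},\quad X\in\mathbb{R}^{d\times m}.$$ The notation $a=\mathcal{O}_{d,m,\eta}(b)$ means $\limsup_{\nu\to\infty}|a/b|<C$ for a constant $C>0$ depending only on $d,m,\eta$; ''uniformly for $X\in B_{\nu,\Sigma,\Omega}(\eta)$'' means that this holds for the supremum of $|a/b|$ over $X\in B_{\nu,\Sigma,\Omega}(\eta)$.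 The degrees of freedom $\nu$ is a real parameter, taken $>2$ so that all expressions make sense. *)

(* Defs.v *)
From HB Require Import structures.
From mathcomp Require Import all_boot all_order all_algebra.
From mathcomp Require Import all_classical all_reals all_analysis.

Set Implicit Arguments.
Unset Strict Implicit.
Unset Printing Implicit Defensive.

Import Order.TTheory GRing.Theory Num.Theory.
Import numFieldNormedType.Exports.

Local Open Scope classical_set_scope.
Local Open Scope ring_scope.

Section MatrixVariateT.
Context {R : realType}.

Definition posdefmx n (A : 'M[R]_n) : Prop :=
  A^T = A /\ forall v : 'cV[R]_n, v != 0 -> 0 < (v^T *m A *m v) 0 0.

(* The symmetric positive definite square root; it exists and is unique when
   [A] is positive definite. *)
Definition sqrtmx n (A : 'M[R]_n) : 'M[R]_n :=
  xget 0 [set S : 'M[R]_n | posdefmx S /\ S *m S = A].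

Definition invsqrtmx n (A : 'M[R]_n) : 'M[R]_n := invmx (sqrtmx A).

(* The eigenvalues with multiplicity, in nonincreasing order; they exist when
   the characteristic polynomial splits over [R], in particular for symmetric
   [A]. *)
Definition spectrum n (A : 'M[R]_n) : n.-tuple R :=
  xget [tuple of nseq n 0]
    [set s : n.-tuple R |
      sorted >=%R s /\ char_poly A = \prod_(a <- s) ('X - a%:P)].

(* [lambda A j] is $\lambda_{j+1}(A)$. *)
Definition lambda n (A : 'M[R]_n) (j : 'I_n) : R := tnth (spectrum A) j.

(* Only real arguments [0 < z] matter here, where the integral is finite. *)
Definition Gamma (z : R) : R :=
  \int[lebesgue_measure]_(t in `]0%R, +oo[) (t `^ (z - 1) * expR (- t)).

(* The index [j] starts at 0, hence [j / 2] and not [(j - 1) / 2]. *)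
Definition multiGamma (d : nat) (z : R) : R :=
  pi `^ (d%:R * (d%:R - 1) / 4) * \prod_(j < d) Gamma (z - j%:R / 2).

Definition matT_density d m (nu : R) (Sigma : 'M[R]_d) (Omega : 'M[R]_m)
    (X : 'M[R]_(d, m)) : R :=
  multiGamma d ((nu + m%:R + d%:R - 1) / 2)
    / multiGamma d ((nu + d%:R - 1) / 2)
  * ((\det (1%:M + nu^-1 *: (invmx Sigma *m X *m invmx Omega *m X^T)))
       `^ (- ((nu + m%:R + d%:R - 1) / 2))
     / ((nu * pi) `^ (m%:R * d%:R / 2)
        * (\det Sigma) `^ (m%:R / 2) * (\det Omega) `^ (d%:R / 2))).

Definition matN_density d m (Sigma : 'M[R]_d) (Omega : 'M[R]_m)
    (X : 'M[R]_(d, m)) : R :=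
  expR (- (\tr (invmx Sigma *m X *m invmx Omega *m X^T) / 2))
  / ((2 * pi) `^ (m%:R * d%:R / 2)
     * (\det Sigma) `^ (m%:R / 2) * (\det Omega) `^ (d%:R / 2)).

Definition Delta d m (Sigma : 'M[R]_d) (Omega : 'M[R]_m)
    (X : 'M[R]_(d, m)) : 'M[R]_(d, m) :=
  invsqrtmx Sigma *m X *m invsqrtmx Omega.

Definition DeltaDeltaT d m (Sigma : 'M[R]_d) (Omega : 'M[R]_m)
    (X : 'M[R]_(d, m)) : 'M[R]_d :=
  Delta Sigma Omega X *m (Delta Sigma Omega X)^T.

Definition delta_lambda d m (nu : R) (Sigma : 'M[R]_d) (Omega : 'M[R]_m)
    (X : 'M[R]_(d, m)) (j : 'I_d) : R :=
  Num.sqrt ((nu - 2) / nu * lambda (DeltaDeltaT Sigma Omega X) j).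

(* The maximum is over nonnegative numbers, so its default value 0 is
   harmless when [0 < d]. *)
Definition bulk d m (nu : R) (Sigma : 'M[R]_d) (Omega : 'M[R]_m) (eta : R) :
    set 'M[R]_(d, m) :=
  [set X | \big[Num.max/0]_(j < d)
             (delta_lambda nu Sigma Omega X j / Num.sqrt (nu - 2))
           <= eta * nu `^ (- (1 / 4))].

(* $\limsup_{\nu\to\infty} \sup_{x \in B_\nu} |a_\nu(x) / b_\nu(x)|$, for real
   $\nu$; the statement $a = O(b)$ uniformly on $B_\nu$ says that it is
   bounded by a constant. *)
Definition limsup_unif (T : Type) (B : R -> set T) (a b : R -> T -> R) :
    \bar R :=
  limf_esup
    (fun nu : R => ereal_sup [set (`|a nu x / b nu x|)%:E | x in B nu])
    (pinfty_nbhs R).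

End MatrixVariateT.

(* Main.v *)
Require Import Defs.
From HB Require Import structures.
From mathcomp Require Import all_boot all_order all_algebra.
From mathcomp Require Import all_classical all_reals all_analysis.
From mathcomp Require Import measurable_realfun.
From mathcomp.real_closed Require Import complex.
From mathcomp Require Import ring lra.

Set Implicit Arguments.
Unset Strict Implicit.
Unset Printing Implicit Defensive.

Import Order.TTheory GRing.Theory Num.Theory.
Import numFieldNormedType.Exports.

Local Open Scope classical_set_scope.
Local Open Scope ring_scope.

(** Writing L x = ln (Gamma ((x + 1) / 2)) - ln (Gamma (x / 2)), the ratio of
    multivariate gamma functions telescopes to the sum of L (nu + i + j) over
    i < m and j < d, so the log-ratio of the densities is a sum of md copies of
    one gamma term and of one term per eigenvalue of Delta Delta^T.

    The functional equation gives L x + L (x + 1) = ln (x / 2), and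
    log-convexity of Gamma makes L nondecreasing, which pins
    L x = ln (x / 2) / 2 + o(1). If p is the truncated asymptotic series of L,
    then p x + p (x + 1) = ln (x / 2) + O(x^-5), so h = L - p satisfies
    |h x| <= |h (x + 1)| + x^-5; summing along x, x + 1, x + 2, ... gives
    h = O(x^-4). The eigenvalue terms only need the Taylor bounds of ln (1 + u),
    which hold for all u >= 0. *)

(** * The gamma function *)

Section Gamma.
Context {R : realType}.
Implicit Types (a z t : R).
Notation mu := (@lebesgue_measure R).

Definition Gamma_fun z t : R := t `^ (z - 1) * expR (- t).

(** The exponential density of rate 1/2, a multiple of which dominates every gamma integrand of
    exponent above 1. *)
Local Notation w := (exponential_pdf (2^-1 : R)).

Let half_gt0 : 0 < (2^-1 : R). Proof. by rewrite invr_gt0. Qed.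

(** From ln s < s at s = t / (2a) comes a ln t <= t/2 + a ln (2a). The factor 2 in [K] undoes the
    1/2 in the density [w]. *)
Lemma powR_expR_le a : 0 < a ->
  exists2 K, 0 <= K & forall t, 0 < t -> t `^ a * expR (- t) <= K * w t.
Proof.
move=> a0; exists (2 * expR (a * ln (2 * a))).
  by rewrite mulr_ge0 ?expR_ge0.
move=> t t0; rewrite exponential_pdfE ?(ltW t0)//.
rewrite mulrACA divff// mul1r /powR gt_eqF// -!expRD ler_expR.
have h : 0 < t / (2 * a) by rewrite divr_gt0// mulr_gt0.
have := ln_sublinear h; rewrite ln_div ?posrE ?mulr_gt0// => /ltW.
rewrite -(ler_pM2l a0) mulrBr => H.
have E : a * (t / (2 * a)) = t / 2 by field; rewrite gt_eqF.
rewrite E in H; lra.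
Qed.

Lemma integrable_exponential_pdf_gt0 :
  mu.-integrable `]0%R, +oo[ (EFin \o w).
Proof.
have := @integrable_exponential_pdf R 2^-1 half_gt0; exact: integrableS.
Qed.

Lemma measurable_Gamma_fun z : measurable_fun setT (Gamma_fun z).
Proof.
apply: measurable_funM => //.
exact: measurableT_comp.
Qed.

Lemma integrable_Gamma_fun z : 1 < z ->
  mu.-integrable `]0%R, +oo[ (EFin \o Gamma_fun z).
Proof.
move=> z1; have [|K K0 HK] := @powR_expR_le (z - 1); first lra.
apply: (@le_integrable _ _ _ mu _ _ _ (EFin \o (fun t => K * w t))) => //=.
- apply/measurable_EFinP; apply: measurable_funTS.
  exact: measurable_Gamma_fun.
- move=> t; rewrite in_itv/= andbT => t0; rewrite lee_fin.
  rewrite !ger0_norm ?mulr_ge0 ?expR_ge0 ?powR_ge0//; first exact: HK.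
  by rewrite exponential_pdf_ge0// invr_ge0.
- have := integrableZl _ _ integrable_exponential_pdf_gt0; apply => //.
Qed.

(** On [1, 2] the integrand is at least e^-2, since t^(z-1) >= 1 there. *)
Lemma Gamma_gt0 z : 1 < z -> 0 < Gamma z.
Proof.
move=> z1.
have i1 := integrable_Gamma_fun z1.
have sub : `[1%R, 2%R] `<=` (`]0%R, +oo[ : set R).
  by move=> t /=; rewrite !in_itv/= andbT => /andP[+ _]; exact: lt_le_trans.
have i2 : mu.-integrable `[1%R, 2%R] (EFin \o Gamma_fun z).
  by apply: integrableS i1.
apply: (@lt_le_trans _ _ (\int[mu]_(t in `[1%R, 2%R]) Gamma_fun z t)).
  apply: (@lt_le_trans _ _ (\int[mu]_(t in `[1%R, 2%R]) expR (-2))).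
    rewrite Rintegral_cst//= lebesgue_measure_itv/= lte_fin ltr1n/=.
    by rewrite mulr_gt0 ?expR_gt0//; lra.
  apply: le_Rintegral => //.
    apply: continuous_compact_integrable; first exact: segment_compact.
    exact/continuous_subspaceT/cst_continuous.
  move=> t; rewrite /= in_itv/= => /andP[t1 t2].
  rewrite /Gamma_fun -[leLHS]mul1r.
  rewrite ler_pM ?expR_ge0 ?ler_expR ?lerN2//.
  by rewrite -[leLHS](powRr0 t) ler_powR// subr_ge0 ltW.
rewrite /Gamma /Rintegral fine_le ?integrable_fin_num//.
apply: ge0_subset_integral => //=.
  apply/measurable_EFinP; apply: measurable_funTS.
  exact: measurable_Gamma_fun.
by move=> t _; rewrite lee_fin mulr_ge0 ?powR_ge0 ?expR_ge0.
Qed.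

(** The quadratic c^2 u - 2 c v + x taken at its minimiser c = v / u, as in the proof of the
    Cauchy-Schwarz inequality. *)
Let sqr_le_of_quadratic (u v x : R) : 0 < u ->
  2 * (v / u) * v <= (v / u) ^+ 2 * u + x -> v ^+ 2 <= u * x.
Proof.
move=> u0; rewrite -(ler_pM2l u0).
have -> : u * (2 * (v / u) * v) = 2 * v ^+ 2 by field; rewrite gt_eqF.
have -> : u * ((v / u) ^+ 2 * u + x) = v ^+ 2 + u * x by field; rewrite gt_eqF.
lra.
Qed.

(** Cauchy-Schwarz by hand: integrate t^(z-1) e^-t (c - sqrt t)^2 >= 0 with the optimal c. This
    midpoint case of log-convexity is what makes [half_step] nondecreasing along unit steps. *)
Lemma Gamma_log_convex z : 1 < z ->
  Gamma (z + 2^-1) ^+ 2 <= Gamma z * Gamma (z + 1).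
Proof.
move=> z1; have G0 := Gamma_gt0 z1; set c := Gamma (z + 2^-1) / Gamma z.
have z2 : 1 < z + 2^-1 by lra.
have z3 : 1 < z + 1 by lra.
have iG u : 1 < u -> forall k,
    mu.-integrable `]0%R, +oo[ (EFin \o (fun t => k * Gamma_fun u t)).
  move=> u1 k; have := integrableZl _ k (integrable_Gamma_fun u1); exact.
have : \int[mu]_(t in `]0%R, +oo[) (2 * c * Gamma_fun (z + 2^-1) t) <=
    \int[mu]_(t in `]0%R, +oo[)
      (c ^+ 2 * Gamma_fun z t + Gamma_fun (z + 1) t).
  apply: le_Rintegral => //; first exact: iG.
    have := integrableD _ (iG _ z1 (c ^+ 2)) (integrable_Gamma_fun z3); exact.
  move=> t /=; rewrite in_itv/= andbT => t0.
  rewrite /Gamma_fun.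
  have -> : z + 2^-1 - 1 = (z - 1) + 2^-1 by ring.
  have -> : z + 1 - 1 = (z - 1) + 1 by ring.
  move: (z - 1) => a.
  have t0' : t != 0 by rewrite gt_eqF.
  rewrite !powRD ?t0' ?implybT// powRr1 ?(ltW t0)// -subr_ge0.
  rewrite powR12_sqrt ?(ltW t0)//.
  rewrite [leRHS](_ : _ = t `^ a * expR (- t) * (c - Num.sqrt t) ^+ 2);
    last first.
    by rewrite -[X in _ * X * _](sqr_sqrtr (ltW t0)); ring.
  apply: mulr_ge0; last exact: sqr_ge0.
  by apply: mulr_ge0; rewrite ?powR_ge0 ?expR_ge0.
rewrite RintegralD//; [|exact: iG|exact: integrable_Gamma_fun].
rewrite !RintegralZl//; [|exact: integrable_Gamma_fun..].
by rewrite -/(Gamma _) -/(Gamma _) -/(Gamma _); exact: sqr_le_of_quadratic.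
Qed.

(** The function is [Gamma_fun (z + 1)]; integrating its derivative over the half-line gives the
    functional equation. *)
Lemma is_derive_Gamma_fun z t : 0 < t ->
  is_derive t 1 (fun x : R => x `^ z * expR (- x))
    (z * Gamma_fun z t - Gamma_fun (z + 1) t).
Proof.
move=> t0.
have h1 := @is_derive1_powR R z t t0.
have h2 : is_derive t 1 (fun x : R => expR (- x)) (- expR (- t)).
  have := @is_derive1_comp R expR (fun x => - x) t (expR (-t)) (-1) _ _.
  by rewrite mulrN1; apply; exact: is_derive_eq.
by apply: is_derive_eq; rewrite /Gamma_fun addrK /GRing.scale /=; ring.
Qed.

Lemma Gamma_fun_continuous z : {in `]0%R, +oo[, continuous (Gamma_fun z)}.
Proof.
move=> t; rewrite in_itv/= andbT => t0.
have [+ _] := is_derive_Gamma_fun (z - 1) t0.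
by move=> /derivable1_diffP/differentiable_continuous.
Qed.

Lemma Gamma_fun0 z : 1 < z -> Gamma_fun z 0 = 0.
Proof. by move=> z1; rewrite /Gamma_fun powR0 ?mul0r// subr_eq0 gt_eqF. Qed.

Lemma Gamma_fun_cvg0 z : 1 < z -> Gamma_fun z x @[x --> 0^'+] --> Gamma_fun z 0.
Proof.
move=> z1; rewrite Gamma_fun0// -[X in _ --> X](mul0r (expR (- (0 : R)))).
apply: cvgM; first by apply: powR_cvg0; rewrite subr_gt0.
apply: cvg_at_right_filter.
apply: continuous_comp; first exact: opp_continuous.
exact: continuous_expR.
Qed.

Lemma expR_half_cvgy : expR (- (2^-1 * x)) @[x --> +oo%R] --> (0 : R).
Proof.
apply: (@cvg_comp _ _ _ (fun x : R => 2^-1 * x) (fun x => expR (- x)) _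
  (pinfty_nbhs R)); last exact: cvgr_expR.
by apply: gt0_cvgMry; rewrite // invr_gt0.
Qed.

Lemma Gamma_fun_cvgy z : 1 < z -> Gamma_fun z x @[x --> +oo%R] --> (0 : R).
Proof.
move=> z1; have [|K K0 HK] := @powR_expR_le (z - 1).
  by rewrite subr_gt0.
apply: (@squeeze_cvgr _ _ _ _ (fun=> 0)
  (fun x => K * (2^-1 * expR (- (2^-1 * x))))).
- near=> t; rewrite mulr_ge0 ?powR_ge0 ?expR_ge0//=.
  have t0 : 0 < t by near: t; exact: nbhs_pinfty_gt.
  by have := HK t t0; rewrite exponential_pdfE ?mulNr// ltW.
- exact: cvg_cst.
- rewrite -[X in _ --> X](mulr0 K); apply: cvgMl_tmp.
  rewrite -[X in _ --> X](mulr0 2^-1); apply: cvgMl_tmp.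
  exact: expR_half_cvgy.
Unshelve. end_near. Qed.

(* The summand [K * w x] makes the integrand nonnegative, as the fundamental
   theorem of calculus on a half-line requires. *)
Lemma Rintegral_Gamma_fun_diff z : 1 < z -> exists K0, forall K, K0 <= K ->
  \int[mu]_(x in `[0%R, +oo[)
    (Gamma_fun (z + 1) x - z * Gamma_fun z x + K * w x) = K.
Proof.
move=> z1; have [|K0 K00 HK] := @powR_expR_le (z - 1).
  by rewrite subr_gt0.
(* From this value on, [K * w] dominates [z * Gamma_fun z], the only negative part of the
   integrand. *)
exists (z * K0) => K KK0.
have z2 : 1 < z + 1 by rewrite ltrDr (lt_trans _ z1).
have wC : {within `[0, +oo[, continuous w}.
  exact: within_continuous_exponential_pdf.
have z0 : 0 < z by rewrite (lt_trans _ z1).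
have K'0 : 0 <= K by rewrite (le_trans _ KK0)// mulr_ge0// ltW.
have w0 x : 0 <= w x by apply: exponential_pdf_ge0; rewrite invr_ge0.
have dF (x : R) : 0 < x -> is_derive x 1
    (fun x : R => - Gamma_fun (z + 1) x + - (K * expR (- (2^-1 * x))))
    (Gamma_fun (z + 1) x - z * Gamma_fun z x + K * w x).
  move=> x0; rewrite exponential_pdfE ?(ltW x0)//.
  have h1 : is_derive x 1 (Gamma_fun (z + 1))
      (z * Gamma_fun z x - Gamma_fun (z + 1) x).
    have := is_derive_Gamma_fun z x0.
    by rewrite (_ : (fun x => x `^ z * expR (- x)) = Gamma_fun (z + 1))//;
       apply/funext => y; rewrite /Gamma_fun addrK.
  have h2 : is_derive x 1 (fun x : R => expR (- (2^-1 * x)))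
      (- 2^-1 * expR (- (2^-1 * x))).
    have h3 : is_derive x 1 (fun x : R => - (2^-1 * x)) (- 2^-1).
      by apply: is_derive_eq; rewrite /GRing.scale/= mulr1.
    have := @is_derive1_comp R expR (fun x => - (2^-1 * x)) x
      (expR (- (2^-1 * x))) (- 2^-1) _ _.
    by rewrite (mulrC (expR _)); apply.
  apply: is_derive_eq; rewrite /GRing.scale/= !mulNr; ring.
(* The antiderivative tends to 0 at infinity and equals [- K] at 0. *)
rewrite (@Rintegral_ge0_continuous_FTC2y _ _
  (fun x => - (Gamma_fun (z + 1) x) + - (K * expR (- (2^-1 * x)))) _ 0) //.
- by rewrite Gamma_fun0// mulr0 oppr0 add0r sub0r opprK expR0 mulr1.
- move=> x; rewrite le_eqVlt => /predU1P[<-|x0].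
    by rewrite !Gamma_fun0// mulr0 subrr add0r mulr_ge0.
  rewrite -addrA addr_ge0 ?mulr_ge0 ?powR_ge0 ?expR_ge0// addrC subr_ge0.
  apply: (@le_trans _ _ (z * (K0 * w x))); last by rewrite mulrA ler_wpM2r.
  by rewrite ler_pM2l// HK.
- apply/continuous_within_itvcyP; split.
    move=> x x0; apply: cvgD; first apply: cvgB.
    + exact: Gamma_fun_continuous.
    + by apply: cvgMl_tmp; exact: Gamma_fun_continuous.
    + by apply: cvgMl_tmp; exact: in_continuous_exponential_pdf.
  apply: cvgD; first apply: cvgB.
  + exact: Gamma_fun_cvg0.
  + by apply: cvgMl_tmp; exact: Gamma_fun_cvg0.
  + by apply: cvgMl_tmp; move/continuous_within_itvcyP : wC => [].
- rewrite -[X in _ --> X]addr0; apply: cvgD.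
    by rewrite -oppr0; apply: cvgN; exact: Gamma_fun_cvgy.
  rewrite -oppr0; apply: cvgN; rewrite -[X in _ --> X](mulr0 K).
  apply: cvgMl_tmp.
  exact: expR_half_cvgy.
- by move=> x x0; have [] := dF x x0.
- apply: cvgD; first by apply: cvgN; exact: Gamma_fun_cvg0.
  apply: cvgN; apply: cvgMl_tmp; apply: cvg_at_right_filter.
  apply: continuous_comp; last exact: continuous_expR.
  by apply: cvgN; apply: cvgMl_tmp.
- move=> x; rewrite in_itv/= andbT => x0; have [_ <-] := dF x x0.
  by rewrite derive1E.
Qed.

(** The identity at [k] and at [k + 1] forces [y = 1], so the auxiliary mass [K * y] cancels without
    computing the integral of [w]. *)
Let eq_of_affine_identity (u v y z k : R) :
  (forall K, k <= K -> u - z * v + K * y = K) -> u = z * v.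
Proof.
move=> H; have H1 := H k (lexx _).
have := H (k + 1); rewrite lerDl ler01 => /(_ isT) H2.
have y1 : y = 1 by move: H1 H2; rewrite mulrDl; lra.
move: H1; rewrite y1; lra.
Qed.

Lemma GammaS z : 1 < z -> Gamma (z + 1) = z * Gamma z.
Proof.
move=> z1; have [K0 HK] := Rintegral_Gamma_fun_diff z1.
have z2 : 1 < z + 1 by rewrite ltrDr (lt_trans _ z1).
apply: (@eq_of_affine_identity _ _ (\int[mu]_(x in `]0%R, +oo[) w x) _ K0).
move=> K /HK {2}<-.
have iG := integrable_Gamma_fun z1.
have iG1 := integrable_Gamma_fun z2.
have izG : mu.-integrable `]0%R, +oo[ (EFin \o (fun t => z * Gamma_fun z t)).
  have := integrableZl _ z iG; exact.
have iKw : mu.-integrable `]0%R, +oo[ (EFin \o (fun t => K * w t)).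
  have := integrableZl _ K integrable_exponential_pdf_gt0; exact.
have iB : mu.-integrable `]0%R, +oo[
    (EFin \o (fun t => Gamma_fun (z + 1) t - z * Gamma_fun z t)).
  have := integrableB _ iG1 izG; exact.
(* [Gamma] integrates over the open half-line, the fundamental theorem over the closed one; the
   endpoint has measure zero. *)
rewrite -Rintegral_itv_obnd_cbnd; last first.
  have := integrableD _ iB iKw; exact.
rewrite RintegralD// RintegralB// (RintegralZl _ _ iG)// RintegralZl//.
exact: integrable_exponential_pdf_gt0.
Qed.
End Gamma.

(** * Elementary asymptotics *)

Section Asymptotics.
Context {R : realType}.
Implicit Types (u v x y k nu : R).

Lemma ge0_derive_le (f df : R -> R) b : 0 <= b ->
  (forall x, 0 <= x <= b -> is_derive x 1 f (df x)) ->
  (forall x, 0 <= x <= b -> 0 <= df x) -> f 0 <= f b.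
Proof.
move=> b0 fd df0.
have [||c] := @MVT_segment R f df 0 b b0.
- by move=> x; rewrite in_itv/= => /andP[x0 xb]; apply: fd; rewrite !ltW.
- by apply: derivable_within_continuous => x; rewrite in_itv/= => /fd[].
by rewrite in_itv/= => /df0 dfc fE; rewrite -subr_ge0 fE mulr_ge0// subr0.
Qed.

Lemma is_derive_ln1D x : -1 < x ->
  is_derive x 1 (fun x : R => ln (1 + x)) (1 + x)^-1.
Proof.
move=> x1; have x10 : 0 < 1 + x by rewrite -ltrBlDl sub0r.
have h := is_derive1_ln x10.
have := @is_derive1_comp R (@ln R) (fun x => 1 + x) x (1 + x)^-1 1 _ _.
by rewrite mulr1; apply; apply: is_derive_eq; rewrite add0r mulr1.
Qed.

(** The remainder vanishes at 0 and has derivative x^4 / (1 + x), which lies between 0 and x^4. *)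
Lemma ln1D_taylor4 u : 0 <= u ->
  0 <= ln (1 + u) - (u - u ^+ 2 / 2 + u ^+ 3 / 3 - u ^+ 4 / 4) <= u ^+ 5 / 5.
Proof.
move=> u0.
pose f x : R := ln (1 + x) - (x - x ^+ 2 / 2 + x ^+ 3 / 3 - x ^+ 4 / 4).
have df x : 0 <= x <= u -> is_derive x 1 f (x ^+ 4 / (1 + x)).
  move=> /andP[x0 _]; have x1 : -1 < x by lra.
  have h := is_derive_ln1D x1.
  apply: is_derive_eq; rewrite /GRing.scale/=.
  by field; rewrite gt_eqF//; lra.
have f0 : f 0 = 0 by rewrite /f addr0 ln1 !expr0n/=; ring.
apply/andP; split.
  rewrite -/(f u) -f0.
  apply: (@ge0_derive_le _ (fun x => x ^+ 4 / (1 + x))) => //.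
  by move=> x /andP[x0 _]; rewrite divr_ge0 ?exprn_ge0 ?addr_ge0.
rewrite -/(f u) -subr_ge0.
pose g x := x ^+ 5 / 5 - f x.
have g0 : g 0 = 0 by rewrite /g f0 expr0n/= mul0r subr0.
suff : g 0 <= g u by rewrite g0.
apply: (@ge0_derive_le g (fun x => x ^+ 4 - x ^+ 4 / (1 + x)) u u0).
  move=> x xu; have h := df x xu.
  apply: is_derive_eq; rewrite /GRing.scale/=; field.
  by case/andP: xu => *; rewrite gt_eqF//; lra.
move=> x /andP[x0 _]; rewrite subr_ge0 ler_pdivrMr; last by lra.
by rewrite mulrDr mulr1 lerDl mulr_ge0 ?exprn_ge0.
Qed.

(** The remainder has derivative x^3 / (1 - x), which is at most 2 x^3 as long as x <= 1/2. *)
Lemma ln1B_taylor3 v : 0 <= v <= 1 / 2 ->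
  0 <= - ln (1 - v) - (v + v ^+ 2 / 2 + v ^+ 3 / 3) <= v ^+ 4 / 2.
Proof.
move=> /andP[v0 v2].
pose f x : R := - ln (1 - x) - (x + x ^+ 2 / 2 + x ^+ 3 / 3).
have df x : 0 <= x <= v -> is_derive x 1 f (x ^+ 3 / (1 - x)).
  move=> /andP[x0 xv]; have x1 : -1 < - x by lra.
  have h := is_derive_ln1D x1.
  have h2 : is_derive x 1 (fun x : R => ln (1 - x)) (- (1 - x)^-1).
    have := @is_derive1_comp R (fun x => ln (1 + x)) (fun x => - x) x
      (1 - x)^-1 (-1) _ _.
    by rewrite mulrN1; apply; exact: is_derive_eq.
  apply: is_derive_eq; rewrite /GRing.scale/=; field; rewrite gt_eqF//; lra.
have f0 : f 0 = 0 by rewrite /f subr0 ln1 !expr0n/=; ring.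
apply/andP; split.
  rewrite -/(f v) -f0.
  apply: (@ge0_derive_le _ (fun x => x ^+ 3 / (1 - x))) => //.
  move=> x /andP[x0 xv]; rewrite divr_ge0 ?exprn_ge0//; lra.
rewrite -/(f v) -subr_ge0.
pose g x := x ^+ 4 / 2 - f x.
have g0 : g 0 = 0 by rewrite /g f0 expr0n/= mul0r subr0.
suff : g 0 <= g v by rewrite g0.
apply: (@ge0_derive_le g (fun x => 2 * x ^+ 3 - x ^+ 3 / (1 - x)) v v0).
  move=> x xu; have h := df x xu.
  apply: is_derive_eq; rewrite /GRing.scale/=; field.
  by case/andP: xu => *; rewrite gt_eqF//; lra.
move=> x /andP[x0 xv]; rewrite subr_ge0 ler_pdivrMr; last by lra.
rewrite mulrAC ler_peMl ?exprn_ge0//; lra.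
Qed.

(* The asymptotic series of [ln (Gamma ((x + 1) / 2)) - ln (Gamma (x / 2))],
   up to [O(x ^- 5)]. *)
Definition half_shift_main x : R := ln (x / 2) / 2 - x^-1 / 4 + x ^- 3 / 24.

(** In the variable u = 1/x everything but ln (1 + u) is rational, and the terms through u^4 cancel.
    What is left is half a Taylor remainder minus a rational function of order u^6. *)
Lemma half_shift_main_add x : 1 <= x ->
  `|half_shift_main x + half_shift_main (x + 1) - ln (x / 2)| <= x ^- 5.
Proof.
move=> x1; have x0 : 0 < x by lra.
have u0 : 0 < x^-1 by rewrite invr_gt0.
have u1 : x^-1 <= 1 by rewrite invf_le1.
have /andP[l1 l2] := ln1D_taylor4 (ltW u0).
have lnE : ln ((x + 1) / 2) = ln (x / 2) + ln (1 + x^-1).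
  rewrite -lnM ?posrE ?divr_gt0//; last by lra.
  by congr ln; field; rewrite gt_eqF.
rewrite /half_shift_main lnE -exprVn.
have -> : (x + 1)^-1 = x^-1 / (1 + x^-1) by field; rewrite !gt_eqF//; lra.
have -> : (x + 1) ^- 3 = (x^-1 / (1 + x^-1)) ^+ 3.
  by field; rewrite !gt_eqF//; lra.
rewrite -exprVn.
move: (x^-1) u0 u1 l1 l2 => u u0 u1.
set l := ln (1 + u); set P := (X in l - X) => l1 l2.
set E := (X in `|X| <= _).
have EE : E = (l - P) / 2 - (4 * u ^+ 6 + 3 * u ^+ 7) / (24 * (1 + u) ^+ 3).
  by rewrite /E /P; field; rewrite gt_eqF//; lra.
have u5 : 0 <= u ^+ 5 by rewrite exprn_ge0// ltW.
have q1 : 0 <= (4 * u ^+ 6 + 3 * u ^+ 7) / (24 * (1 + u) ^+ 3).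
  by rewrite divr_ge0 ?addr_ge0 ?mulr_ge0 ?exprn_ge0 ?addr_ge0// ltW.
(* Here 4u + 3u^2 <= 7 because u <= 1, and (1 + u)^3 >= 1. *)
have q2 : (4 * u ^+ 6 + 3 * u ^+ 7) / (24 * (1 + u) ^+ 3) <= u ^+ 5 * (7 / 24).
  rewrite ler_pdivrMr ?mulr_gt0 ?exprn_gt0//; try lra.
  have -> : 4 * u ^+ 6 + 3 * u ^+ 7 = u ^+ 5 * (4 * u + 3 * u ^+ 2) by ring.
  rewrite -[leRHS]mulrA ler_wpM2l//.
  have : u ^+ 2 <= 1 by rewrite expr_le1// ltW.
  have : 1 <= (1 + u) ^+ 3 by rewrite exprn_ege1//; lra.
  lra.
rewrite EE ler_norml; apply/andP; split; lra.
Qed.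

(** Makes the errors x^-5 summable along x, x + 1, ... by telescoping. With denominators cleared it
    reads (x^2 - 1) (x - 1)^3 <= x^2 x^3. *)
Lemma invXn_telescope x : 1 < x -> x ^- 5 <= (x - 1) ^- 4 - x ^- 4.
Proof.
move=> x1; have x0 : 0 < x by lra.
have y0 : 0 < x - 1 by lra.
have -> : (x - 1) ^- 4 - x ^- 4
    = (x ^+ 5 - x * (x - 1) ^+ 4) / ((x - 1) ^+ 4 * x ^+ 5).
  by field; rewrite !gt_eqF.
have -> : x ^- 5 = (x - 1) ^+ 4 / ((x - 1) ^+ 4 * x ^+ 5).
  by field; rewrite !gt_eqF.
rewrite ler_pM2r ?invr_gt0 ?mulr_gt0 ?exprn_gt0//.
rewrite lerBrDr -[X in X + _]mul1r -mulrDl.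
have -> : (1 + x) * (x - 1) ^+ 4 = (x ^+ 2 - 1) * (x - 1) ^+ 3 by ring.
rewrite (exprD x 2 3) ler_pM ?exprn_ge0//; try lra.
  by rewrite subr_ge0 exprn_ege1// ltW.
by rewrite ler_pXn2r// ?nnegrE; lra.
Qed.

(** * Nondecreasing solutions of the difference equation L x + L (x + 1) = ln (x / 2) *)

Section HalfShift.
(** [L] is later instantiated with [half_step]; the asymptotics rest on the two hypotheses alone.
    The bound 3 puts x / 2 above 1, where the gamma lemmas apply. *)
Variable L : R -> R.
Hypothesis L_add : forall x, 3 <= x -> L x + L (x + 1) = ln (x / 2).
Hypothesis L_le : forall x, 3 <= x -> L x <= L (x + 1).

Local Notation h x := (L x - half_shift_main x).

Lemma half_shift_step x : 3 <= x -> `|h x| <= `|h (x + 1)| + x ^- 5.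
Proof.
move=> x3; have := L_add x3.
have := @half_shift_main_add x.
rewrite (le_trans _ x3)// ?ler1n// => /(_ isT) H E.
rewrite -lerBlDl; apply: le_trans H; rewrite -E.
rewrite (_ : half_shift_main x + half_shift_main (x + 1) - (L x + L (x + 1)) =
  - (h x + h (x + 1))); last by ring.
by rewrite normrN; apply: le_trans (lerB_normD _ _); rewrite lexx.
Qed.

(** Monotonicity places 2 L x between ln ((x - 1) / 2) and ln (x / 2), which differ by at most 1 /
    (x - 1). Its only purpose is decay at infinity, where the telescoping sum ends. *)
Lemma half_shift_crude x : 4 <= x -> `|h x| <= (x - 1)^-1.
Proof.
move=> x4.
have x0 : 0 < x by lra.
have E1 : L x + L (x + 1) = ln (x / 2) by apply: L_add; lra.
have le1 : L x <= L (x + 1) by apply: L_le; lra.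
have E2 : L (x - 1) + L x = ln ((x - 1) / 2).
  have := L_add (x := x - 1); rewrite subrK; apply; lra.
have le2 : L (x - 1) <= L x.
  have := L_le (x := x - 1); rewrite subrK; apply; lra.
have lnE : ln (x / 2) = ln ((x - 1) / 2) + ln (1 + (x - 1)^-1).
  have y0 : 0 < x - 1 by lra.
  have y1 : 0 < 1 + (x - 1)^-1 by rewrite addr_gt0 ?invr_gt0.
  rewrite -lnM ?posrE ?divr_gt0//.
  by congr ln; field; rewrite gt_eqF//; lra.
have lnle : ln (1 + (x - 1)^-1) <= (x - 1)^-1.
  apply: le_ln1Dx; have : 0 < (x - 1)^-1 by rewrite invr_gt0; lra.
  lra.
have i1 : 0 < x^-1 by rewrite invr_gt0.
have i2 : x^-1 <= (x - 1)^-1 by rewrite lef_pV2 ?posrE; lra.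
have i3 : 0 < x ^- 3 by rewrite invr_gt0 exprn_gt0.
have i4 : x ^- 3 <= x^-1.
  rewrite lef_pV2 ?posrE ?exprn_gt0// ler_eXnr//; lra.
rewrite /half_shift_main ler_norml; apply/andP; split; lra.
Qed.

Lemma half_shift_asymp x : 3 <= x -> `|h x| <= (x - 1) ^- 4.
Proof.
move=> x3.
(* The quantity |h x| - (x - 1)^-4 does not decrease along unit steps, and the crude bound makes its
   limit at infinity 0. *)
have tel n : `|h x| - (x - 1) ^- 4 <= `|h (x + n%:R)| - (x + n%:R - 1) ^- 4.
  elim: n => [|n IH]; first by rewrite addr0.
  apply: (le_trans IH); have xn : 3 <= x + n%:R by rewrite ler_wpDr.
  have := half_shift_step xn; have := @invXn_telescope (x + n%:R).
  rewrite (lt_le_trans _ xn) ?ltr1n// => /(_ isT).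
  rewrite -natr1 addrA addrK; lra.
apply/ler_addgt0Pr => e e0.
have [n ne] : exists n : nat, e^-1 <= n%:R.
  by exists (Num.trunc e^-1).+1; rewrite ltW// truncnS_gt.
have := tel n.+1; rewrite -natr1 addrA addrK.
have := @half_shift_crude (x + n%:R + 1).
have n0 : 0 <= n%:R :> R by [].
have -> : 4 <= x + n%:R + 1 by lra.
move=> /(_ isT); rewrite addrK.
have : (x + n%:R)^-1 <= e.
  rewrite -[leRHS]invrK lef_pV2 ?posrE ?invr_gt0//; last by lra.
  by rewrite (le_trans ne)// lerDr; lra.
have : 0 <= (x + n%:R) ^- 4 by rewrite invr_ge0 exprn_ge0//; lra.
lra.
Qed.

(** The expansion through u^3, at u = 1/nu, of one of the md gamma terms, with k = i + j. The
    fraction 33/24 is 4/3 from -ln (1 - 2u) / 2 plus 1/24 from [half_shift_main]. *)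
Definition shift_coef k u : R :=
  u * (3 / 4 + k / 2) + u ^+ 2 * (1 - k ^+ 2 / 4 + k / 4)
  + u ^+ 3 * (33 / 24 + k ^+ 3 / 6 - k ^+ 2 / 4).

(** A generous sum of the remainder bounds: 20 is 16 from [half_shift_asymp] plus 4 from ln (1 -
    2u); the powers of k cover the remainders that involve k. *)
Definition shift_const k : R :=
  20 + k ^+ 5 + k ^+ 4 + 2 * k ^+ 3 + 3 * k ^+ 2 + 3 * k.

Lemma half_shift_expansion k nu : 0 <= k -> 4 <= nu ->
  `|ln (nu / (nu - 2)) / 2 - ln (nu / 2) / 2 + L (nu + k) - shift_coef k nu^-1|
    <= shift_const k / nu ^+ 4.
Proof.
move=> k0 nu4.
have nu0 : 0 < nu by lra.
have nk0 : 0 < nu + k by lra.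
have u0 : 0 < nu^-1 by rewrite invr_gt0.
have u4 : nu^-1 <= 1 / 4 by rewrite div1r lef_pV2 ?posrE.
have hB : `|h (nu + k)| <= 16 * nu^-1 ^+ 4.
  have nk3 : 3 <= nu + k by lra.
  apply: le_trans (half_shift_asymp nk3) _.
  (* The factor 16 comes from nu + k - 1 >= nu / 2. *)
  have -> : 16 * nu^-1 ^+ 4 = (nu / 2) ^- 4 by field; rewrite gt_eqF.
  by rewrite lef_pV2 ?posrE ?exprn_gt0 ?ler_pXn2r ?nnegrE//; lra.
have ln1 : ln (nu / (nu - 2)) = - ln (1 - 2 * nu^-1).
  rewrite -lnV ?posrE; last by lra.
  by congr ln; field; rewrite !gt_eqF//; lra.
have ln2 : ln ((nu + k) / 2) = ln (nu / 2) + ln (1 + k * nu^-1).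
  rewrite -lnM ?posrE ?divr_gt0//; last by rewrite ltr_wpDr// mulr_ge0// ltW.
  by congr ln; field; rewrite gt_eqF.
have inv1 : (nu + k)^-1 = nu^-1 - k * nu^-1 ^+ 2 + k ^+ 2 * nu^-1 ^+ 3
    - k ^+ 3 * nu^-1 ^+ 3 / (nu + k).
  by field; rewrite !gt_eqF.
have inv3 : (nu + k) ^- 3 = nu^-1 ^+ 3
    - (3 * k * nu ^+ 2 + 3 * k ^+ 2 * nu + k ^+ 3) / (nu ^+ 3 * (nu + k) ^+ 3).
  by field; rewrite !gt_eqF.
have r1 : 0 <= k ^+ 3 * nu^-1 ^+ 3 / (nu + k) <= k ^+ 3 * nu^-1 ^+ 4.
  have -> : k ^+ 3 * nu^-1 ^+ 4 = (k ^+ 3 * nu^-1 ^+ 3) * nu^-1 by ring.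
  apply/andP; split.
    by rewrite divr_ge0 ?mulr_ge0 ?exprn_ge0// ltW.
  apply: ler_wpM2l; first by rewrite mulr_ge0 ?exprn_ge0 ?(ltW u0).
  rewrite lef_pV2 ?posrE//; lra.
have r3 : 0 <= (3 * k * nu ^+ 2 + 3 * k ^+ 2 * nu + k ^+ 3)
      / (nu ^+ 3 * (nu + k) ^+ 3)
    <= (3 * k + 3 * k ^+ 2 + k ^+ 3) * nu^-1 ^+ 4.
  have nu2 : nu <= nu ^+ 2 by rewrite ler_eXnr//; lra.
  have nu1 : 1 <= nu ^+ 2 by rewrite exprn_ege1//; lra.
  have k2 : 0 <= k ^+ 2 by rewrite exprn_ge0.
  have k3 : 0 <= k ^+ 3 by rewrite exprn_ge0.
  apply/andP; split.
    by rewrite divr_ge0 ?mulr_ge0 ?exprn_ge0 ?addr_ge0 ?mulr_ge0 ?exprn_ge0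
      ?addr_ge0 ?(ltW nu0).
  apply: (@le_trans _ _ ((3 * k + 3 * k ^+ 2 + k ^+ 3) * nu ^+ 2
    / (nu ^+ 3 * (nu + k) ^+ 3))).
    rewrite ler_wpM2r ?invr_ge0 ?mulr_ge0 ?exprn_ge0 ?(ltW nu0) ?(ltW nk0)//.
    have a1 : k ^+ 2 * nu <= k ^+ 2 * nu ^+ 2 by apply: ler_wpM2l.
    have a2 : k ^+ 3 <= k ^+ 3 * nu ^+ 2 by apply: ler_peMr.
    lra.
  have -> : (3 * k + 3 * k ^+ 2 + k ^+ 3) * nu^-1 ^+ 4 =
     (3 * k + 3 * k ^+ 2 + k ^+ 3) * nu ^+ 2 / (nu ^+ 3 * nu ^+ 3).
    by field; rewrite gt_eqF.
  rewrite ler_wpM2l ?mulr_ge0 ?addr_ge0 ?mulr_ge0 ?exprn_ge0 ?(ltW nu0)//.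
  rewrite lef_pV2 ?posrE ?mulr_gt0 ?exprn_gt0//.
  rewrite ler_wpM2l ?exprn_ge0 ?(ltW nu0)//.
  by rewrite ler_pXn2r ?nnegrE ?(ltW nu0) ?(ltW nk0)//; lra.
have /andP[t1 t2] : 0 <= - ln (1 - 2 * nu^-1)
    - (2 * nu^-1 + (2 * nu^-1) ^+ 2 / 2 + (2 * nu^-1) ^+ 3 / 3)
    <= (2 * nu^-1) ^+ 4 / 2.
  by apply: ln1B_taylor3; lra.
have /andP[t3 t4] := @ln1D_taylor4 (k * nu^-1) (mulr_ge0 k0 (ltW u0)).
have t6 : 0 <= k ^+ 5 * nu^-1 ^+ 4 by rewrite mulr_ge0 ?exprn_ge0 ?(ltW u0).
have t5 : (k * nu^-1) ^+ 5 / 5 <= k ^+ 5 * nu^-1 ^+ 4.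
  have -> : (k * nu^-1) ^+ 5 / 5 = (k ^+ 5 * nu^-1 ^+ 4) * (nu^-1 / 5).
    by field; rewrite gt_eqF.
  by apply: ler_piMr => //; lra.
have t7 : 0 <= k ^+ 4 * nu^-1 ^+ 4 by rewrite mulr_ge0 ?exprn_ge0 ?(ltW u0).
rewrite -exprVn.
(* An exact splitting into error terms: the error of the series of [L], the Taylor remainders of
   both logarithms, the fourth-order Taylor term of ln (1 + k/nu), and the tails of the expansions
   of 1/(nu + k) and its cube. *)
have E : ln (nu / (nu - 2)) / 2 - ln (nu / 2) / 2 + L (nu + k)
    - shift_coef k nu^-1
  = h (nu + k) + (- ln (1 - 2 * nu^-1) - (2 * nu^-1 + (2 * nu^-1) ^+ 2 / 2
    + (2 * nu^-1) ^+ 3 / 3)) / 2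
   + (ln (1 + k * nu^-1) - (k * nu^-1 - (k * nu^-1) ^+ 2 / 2
    + (k * nu^-1) ^+ 3 / 3 - (k * nu^-1) ^+ 4 / 4)) / 2
   - k ^+ 4 * nu^-1 ^+ 4 / 8
   + k ^+ 3 * nu^-1 ^+ 3 / (nu + k) / 4
   - (3 * k * nu ^+ 2 + 3 * k ^+ 2 * nu + k ^+ 3)
     / (nu ^+ 3 * (nu + k) ^+ 3) / 24.
  rewrite /half_shift_main /shift_coef ln2 ln1 inv3.
  move: inv1; move: (k ^+ 3 * _ / _) (_ / (nu ^+ 3 * _)) => Q1 Q3 ->.
  move: (ln (1 - _)) (ln (1 + _)) (ln (nu / 2)) (L _) => *.
  by field; rewrite gt_eqF.
have k2' : 0 <= k * nu^-1 ^+ 4 by rewrite mulr_ge0 ?exprn_ge0 ?(ltW u0).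
have k3' : 0 <= k ^+ 2 * nu^-1 ^+ 4 by rewrite mulr_ge0 ?exprn_ge0 ?(ltW u0).
have k4' : 0 <= k ^+ 3 * nu^-1 ^+ 4 by rewrite mulr_ge0 ?exprn_ge0 ?(ltW u0).
move: hB; rewrite E !ler_norml => /andP[hB1 hB2].
move/andP: r1 => [r1 r2]; move/andP: r3 => [r3 r4].
have e24 : (2 * nu^-1) ^+ 4 / 2 = 8 * nu^-1 ^+ 4.
  by rewrite exprMn; field; rewrite gt_eqF.
rewrite e24 in t2; rewrite /shift_const.
apply/andP; split; lra.
Qed.
End HalfShift.
End Asymptotics.

(** * The gamma terms and the eigenvalue terms of the log-ratio *)

Section Sums.
Context {R : realType}.
Implicit Types (u x y nu l a : R).

(** [s1], [s2], [s3] are the sums of i, i^2, i^3 over i < m. The offset [y] will be the row index of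
    the double sum. *)
Lemma sum_shift_coef_row (m : nat) y u :
  \sum_(i < m) shift_coef (y + i%:R) u =
  let n : R := m%:R in
  let s1 := n * (n - 1) / 2 in
  let s2 := n * (n - 1) * (2 * n - 1) / 6 in
  let s3 := (n * (n - 1) / 2) ^+ 2 in
  u * (3 / 4 * n + (s1 + n * y) / 2)
  + u ^+ 2 * (n - (s2 + 2 * y * s1 + n * y ^+ 2) / 4 + (s1 + n * y) / 4)
  + u ^+ 3 * (33 / 24 * n + (s3 + 3 * y * s2 + 3 * y ^+ 2 * s1 + n * y ^+ 3) / 6
              - (s2 + 2 * y * s1 + n * y ^+ 2) / 4).
Proof.
elim: m => [|m IH]; first by rewrite big_ord0 /=; field.
by rewrite big_ord_recr /= IH /shift_coef -natr1 /=; field.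
Qed.

(** These are exactly the trace-free terms of the expansion in the theorem; each induction step on
    [d] adds the row with offset [d]. *)
Lemma sum_shift_coef (m d : nat) u :
  \sum_(j < d) \sum_(i < m) shift_coef (j%:R + i%:R) u =
  let mr : R := m%:R in let dr : R := d%:R in
  u * (mr * dr * (mr + dr + 1) / 4)
  + u ^+ 2 * (mr * dr / 24
       * (13 - 2 * dr ^+ 2 - 3 * dr * (- 3 + mr) + 9 * mr - 2 * mr ^+ 2))
  + u ^+ 3 * (mr * dr / 24
       * (26 + dr ^+ 3 + 2 * dr ^+ 2 * (- 3 + mr) + 11 * mr
          - 6 * mr ^+ 2 + mr ^+ 3 + dr * (11 - 9 * mr + 2 * mr ^+ 2))).
Proof.
elim: d => [|d IH]; first by rewrite big_ord0 /=; field.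
by rewrite big_ord_recr /= IH sum_shift_coef_row -natr1 /=; field.
Qed.

(** Multiplying the Taylor polynomial of ln (1 + l/nu) by (nu + a) / 2 gives the stated terms and
    one stray a l^4 / (8 nu^4). The Taylor remainder, of order l^5 / nu^5, loses one power of nu in
    the product. *)
Lemma eigenvalue_term l a nu : 0 <= l -> 0 <= a -> 1 <= nu ->
  `|(nu - 2) / nu * l / 2 - (nu + a) / 2 * ln (1 + nu^-1 * l)
    - (nu^-1 * (1 / 4 * l ^+ 2 - (a + 2) / 2 * l)
       + nu^-1 ^+ 2 * (- (1 / 6 * l ^+ 3) + a / 4 * l ^+ 2)
       + nu^-1 ^+ 3 * (1 / 8 * l ^+ 4 - a / 6 * l ^+ 3))|
  <= (1 + a) * (1 + l ^+ 5) / nu ^+ 4.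
Proof.
move=> l0 a0 nu1; have nu0 : 0 < nu by lra.
have u0 : 0 < nu^-1 by rewrite invr_gt0.
have u1 : nu^-1 <= 1 by rewrite invf_le1.
have /andP[t1 t2] := @ln1D_taylor4 _ _ (mulr_ge0 (ltW u0) l0).
move: t1 t2; set T := (X in ln _ - X); move: (ln _) => w t1 t2.
have c0 : 0 <= (nu + a) / 2 by lra.
have := ler_wpM2l c0 t1; rewrite mulr0 => b1.
have := ler_wpM2l c0 t2 => b2.
(* Absorbs the stray fourth power into the fifth power that the error bound contains. *)
have l4 : l ^+ 4 <= 1 + l ^+ 5.
  have [l1|l1] := leP l 1.
    have h1 : l ^+ 4 <= 1 by rewrite expr_le1.
    have h2 : 0 <= l ^+ 5 by rewrite exprn_ge0. lra.
  have : l ^+ 4 <= l ^+ 5 by rewrite ler_weXn2l// ltW. lra.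
have u40 : 0 <= nu^-1 ^+ 4 by rewrite exprn_ge0// ltW.
have l40 : 0 <= l ^+ 4 by rewrite exprn_ge0.
have l50 : 0 <= l ^+ 5 by rewrite exprn_ge0.
have b3 : (nu + a) / 2 * ((nu^-1 * l) ^+ 5 / 5)
    <= (1 + a) / 10 * (l ^+ 5 * nu^-1 ^+ 4).
  have -> : (nu + a) / 2 * ((nu^-1 * l) ^+ 5 / 5)
      = (1 + a * nu^-1) / 10 * (l ^+ 5 * nu^-1 ^+ 4).
    by field; rewrite gt_eqF.
  apply: ler_wpM2r; first by rewrite mulr_ge0.
  have : a * nu^-1 <= a by apply: ler_piMr.
  lra.
have b4 : 0 <= a / 8 * (l ^+ 4 * nu^-1 ^+ 4).
  by apply: mulr_ge0; [rewrite divr_ge0|apply: mulr_ge0].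
have b5 : a / 8 * (l ^+ 4 * nu^-1 ^+ 4) <= a / 8 * ((1 + l ^+ 5) * nu^-1 ^+ 4).
  by apply: ler_wpM2l; [rewrite divr_ge0|apply: ler_wpM2r].
have b6 : 0 <= a * (l ^+ 5 * nu^-1 ^+ 4).
  by apply: mulr_ge0; last exact: mulr_ge0.
have b7 : 0 <= a * nu^-1 ^+ 4 by exact: mulr_ge0.
have b8 : 0 <= l ^+ 5 * nu^-1 ^+ 4 by exact: mulr_ge0.
rewrite -exprVn.
set E := (X in `|X| <= _).
have -> : E = a / 8 * (l ^+ 4 * nu^-1 ^+ 4) - (nu + a) / 2 * (w - T).
  by rewrite /E /T; field; rewrite gt_eqF.
rewrite ler_norml; apply/andP; split; lra.
Qed.

Definition half_step x : R := ln (Gamma ((x + 1) / 2)) - ln (Gamma (x / 2)).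

(** The sum telescopes to ln Gamma (x/2 + 1) - ln Gamma (x/2), to which the functional equation
    applies. *)
Lemma half_step_add x : 3 <= x -> half_step x + half_step (x + 1) = ln (x / 2).
Proof.
move=> x3; have x1 : 1 < x / 2 by lra.
rewrite /half_step.
have -> : (x + 1 + 1) / 2 = x / 2 + 1 by field.
rewrite GammaS// lnM ?posrE ?Gamma_gt0//; last by rewrite (lt_trans _ x1).
by move: (@Gamma R) => G; ring.
Qed.

(** The logarithm of [Gamma_log_convex] at x/2. *)
Lemma half_step_le x : 3 <= x -> half_step x <= half_step (x + 1).
Proof.
move=> x3; have x1 : 1 < x / 2 by lra.
have x2 : 1 < x / 2 + 2^-1 by lra.
have x4 : 1 < x / 2 + 1 by lra.
have := Gamma_log_convex x1.
have := Gamma_gt0 x1; have := Gamma_gt0 x2; have := Gamma_gt0 x4.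
rewrite /half_step.
have -> : (x + 1 + 1) / 2 = x / 2 + 1 by field.
have -> : (x + 1) / 2 = x / 2 + 2^-1 by field.
move: (Gamma _) (Gamma _) (Gamma _) => g1 g2 g3 p1 p2 p3.
rewrite -ler_ln ?posrE ?exprn_gt0 ?mulr_gt0// lnXn// lnM// mulr2n; lra.
Qed.

Lemma sum_half_step (m : nat) x :
  \sum_(i < m) half_step (x + i%:R)
  = ln (Gamma ((x + m%:R) / 2)) - ln (Gamma (x / 2)).
Proof.
elim: m => [|m IH]; first by rewrite big_ord0 addr0 subrr.
rewrite big_ord_recr /= IH /half_step -(natr1 m) (addrA x).
by move: (@Gamma R) => G; ring.
Qed.

(** The hypothesis concerns the smallest argument among the factors, the one at j = d - 1. *)
Lemma multiGamma_gt0 (d : nat) (z : R) :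
  1 < z - (d%:R - 1) / 2 -> 0 < multiGamma d z.
Proof.
move=> hz; rewrite mulr_gt0 ?powR_gt0 ?pi_gt0//.
apply: prodr_gt0 => j _; apply: Gamma_gt0; apply: lt_le_trans hz _.
have : j%:R + 1 <= d%:R :> R by rewrite natr1 ler_nat.
lra.
Qed.

Lemma ln_prod_gt0 (I : Type) (r : seq I) (f : I -> R) :
  (forall i, 0 < f i) -> ln (\prod_(i <- r) f i) = \sum_(i <- r) ln (f i).
Proof.
move=> f0; elim: r => [|i r IH]; first by rewrite !big_nil ln1.
by rewrite !big_cons lnM ?posrE ?IH// prodr_gt0.
Qed.

Lemma ln_multiGamma_ratio (d m : nat) nu : 3 <= nu ->
  ln (multiGamma d ((nu + m%:R + d%:R - 1) / 2)
      / multiGamma d ((nu + d%:R - 1) / 2))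
  = \sum_(j < d) \sum_(i < m) half_step (nu + (j%:R + i%:R)).
Proof.
move=> nu3.
have m0 : 0 <= m%:R :> R by [].
have jd (j : 'I_d) : j%:R + 1 <= d%:R :> R by rewrite natr1 ler_nat.
rewrite /multiGamma -mulf_div divff ?mul1r ?gt_eqF ?powR_gt0 ?pi_gt0//.
rewrite -prodf_div ln_prod_gt0; last first.
  by move=> j; have := jd j => ?; rewrite divr_gt0// Gamma_gt0//; lra.
(* Replacing j by d - 1 - j turns the two arguments into (nu + j + m) / 2 and (nu + j) / 2, which m
   half-steps connect. *)
rewrite (reindex_inj rev_ord_inj) /=; apply: eq_bigr => j _.
under eq_bigr do rewrite addrA.
have := jd j => ?; have j0 : 0 <= j%:R :> R by [].
have -> : (d - j.+1)%:R = d%:R - (j%:R + 1) :> R by rewrite natrB// natr1.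
have -> : (nu + m%:R + d%:R - 1) / 2 - (d%:R - (j%:R + 1)) / 2
    = (nu + j%:R + m%:R) / 2 by field.
have -> : (nu + d%:R - 1) / 2 - (d%:R - (j%:R + 1)) / 2 = (nu + j%:R) / 2.
  by field.
have z1 : 1 < (nu + j%:R) / 2 by lra.
have z2 : 1 < (nu + j%:R + m%:R) / 2 by lra.
rewrite sum_half_step ln_div//; rewrite posrE; exact: Gamma_gt0.
Qed.
End Sums.

(** * Symmetric matrices *)

Section Diagonalization.
Context {R : realType}.

(* The spectral theorem over [R[i]] has real eigenvalues, and real matrices
   similar over [R[i]] are similar over [R]. *)
Lemma symmetric_diagonalizable n (A : 'M[R]_n) : A^T = A ->
  exists (P : 'M[R]_n) (l : 'rV[R]_n), P \in unitmx /\ P *m A = diag_mx l *m P.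
Proof.
move=> Asym; set toC := (real_complex R : {rmorphism R -> R[i]}).
have realC m k (B : 'M[R]_(m, k)) : map_mx toC B \is a mxOver Num.real.
  by apply/mxOverP => i j; rewrite mxE; apply/complex_realP; exists (B i j).
have ofC m k (B : 'M[R[i]]_(m, k)) : B \is a mxOver Num.real ->
    map_mx toC (map_mx (@complex.Re R) B) = B.
  by move=> /mxOverP rB; apply/matrixP => i j; rewrite !mxE; apply: RRe_real.
have Aherm : map_mx toC A \is hermsymmx.
  apply: realsym_hermsym (realC _ _ A).
  by apply/is_hermitianmxP; rewrite expr0 scale1r map_mx_id// map_trmx Asym.
have [Q [sp [uQ rD AE]]] : exists (Q : 'M[R[i]]_n) (sp : 'rV[R[i]]_n),
    [/\ Q \in unitmx, sp \is a mxOver Num.real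
      & map_mx toC A = invmx Q *m diag_mx sp *m Q].
  exists (spectralmx (map_mx toC A)), (spectral_diag (map_mx toC A)).
  split; [exact: spectral_unit|exact: hermitian_spectral_diag_real|].
  exact/orthomx_spectralP/hermitian_normalmx.
have rdiag : diag_mx sp \is a mxOver Num.real.
  by rewrite -(ofC _ _ sp rD) -map_diag_mx.
have [||| P /andP[rP uP] /similarP PA] :=
  @real_similar _ _ (map_mx toC A) (diag_mx sp).
- exists Q; first exact: uQ.
  apply/(similarP uQ).
  by rewrite AE -mulmxA (mulKVmx uQ).
- exact: realC.
- exact: rdiag.
(* The conjugating matrix and the eigenvalues are real, so taking real parts loses nothing and the
   relation descends to [R]. *)
exists (map_mx (@complex.Re R) P), (map_mx (@complex.Re R) sp).
split; first by rewrite -(map_unitmx toC) ofC.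
apply: (@map_mx_inj _ _ toC).
by rewrite !map_mxM map_diag_mx !ofC ?PA.
Qed.

(** Newton interpolation: [q] vanishes on the earlier nodes and not at the new one, so a multiple of
    it corrects the value there. *)
Lemma exists_interpolating_poly (s : seq R) (f : R -> R) :
  exists p : {poly R}, forall x, x \in s -> p.[x] = f x.
Proof.
elim: s => [|a s [p pE]]; first by exists 0.
have [as_|nas] := boolP (a \in s).
  by exists p => x; rewrite inE => /predU1P[->|]; exact: pE.
pose q := \prod_(b <- s) ('X - b%:P).
have qs x : (q.[x] == 0) = (x \in s).
  by rewrite -rootE root_prod_XsubC.
have qa : q.[a] != 0 by rewrite qs.
exists (p + ((f a - p.[a]) / q.[a]) *: q) => x.
rewrite inE !hornerE => /predU1P[->|xs].
  by rewrite divfK// addrC subrK.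
have /eqP -> : q.[x] == 0 by rewrite qs.
by rewrite mulr0 addr0 pE.
Qed.

Lemma symmetric_horner_mx n (A : 'M[R]_n.+1) (p : {poly R}) :
  A^T = A -> (horner_mx A p)^T = horner_mx A p.
Proof.
move=> As; elim/poly_ind: p => [|p c IH]; first by rewrite rmorph0 trmx0.
rewrite rmorphD rmorphM /= horner_mx_X horner_mx_C linearD /=.
rewrite trmx_mul IH As tr_scalar_mx.
by congr (_ + _); apply: comm_mx_horner.
Qed.

Lemma sqr_colvec_ge0 n (v : 'cV[R]_n) : 0 <= (v^T *m v) 0 0.
Proof. by rewrite mxE sumr_ge0// => i _; rewrite mxE -expr2 sqr_ge0. Qed.

Lemma sqr_colvec_gt0 n (v : 'cV[R]_n) : v != 0 -> 0 < (v^T *m v) 0 0.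
Proof.
move=> v0; rewrite lt_neqAle sqr_colvec_ge0 andbT eq_sym.
apply: contra v0 => /eqP; rewrite mxE => /eqP.
rewrite psumr_eq0; last by move=> i _; rewrite mxE -expr2 sqr_ge0.
move=> /allP H; apply/eqP/matrixP => i j; rewrite ord1 [RHS]mxE.
have := H i (mem_index_enum _); rewrite mxE -expr2 sqrf_eq0 => /eqP.
exact.
Qed.

(** The rows of [P] are left eigenvectors of [A]; the sign of the quadratic form thus becomes the
    sign of the eigenvalue. *)
Lemma rayleigh_diag n (A P : 'M[R]_n) (l : 'rV[R]_n) i :
  P *m A = diag_mx l *m P ->
  let v := (row i P)^T in (v^T *m A *m v) 0 0 = l 0 i * (v^T *m v) 0 0.
Proof.
move=> PA v; rewrite /v trmxK -row_mul PA row_mul.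
have -> : row i (diag_mx l) *m P = l 0 i *: row i P.
  apply/rowP => j; rewrite !mxE (bigD1 i)//= big1 ?addr0.
    by rewrite !mxE eqxx mulr1n.
  by move=> k ki; rewrite !mxE eq_sym (negbTE ki) mulr0n mul0r.
by rewrite -scalemxAl mxE.
Qed.

Lemma row_unitmx_neq0 n (P : 'M[R]_n) i : P \in unitmx -> (row i P)^T != 0.
Proof.
move=> uP; apply/eqP => /(congr1 trmx); rewrite trmxK trmx0 => r0.
have : row i (P *m invmx P) = 0 by rewrite row_mul r0 mul0mx.
rewrite mulmxV// => /rowP/(_ i); rewrite !mxE eqxx => /eqP.
by rewrite oner_eq0.
Qed.

Lemma posdefmx_diag n (A : 'M[R]_n) : posdefmx A ->
  exists (P : 'M[R]_n) (l : 'rV[R]_n), [/\ P \in unitmx,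
    P *m A = diag_mx l *m P & forall i, 0 < l 0 i].
Proof.
move=> [As Ap]; have [P [l [uP PA]]] := symmetric_diagonalizable As.
exists P, l; split => // i.
have v0 := row_unitmx_neq0 i uP; have := Ap _ v0; rewrite (rayleigh_diag i PA).
by rewrite pmulr_lgt0// sqr_colvec_gt0.
Qed.

(** The eigenvalues are nonnegative because v^T B B^T v is the squared norm of B^T v. *)
Lemma gram_diag n m (B : 'M[R]_(n, m)) :
  exists (P : 'M[R]_n) (l : 'rV[R]_n), [/\ P \in unitmx,
    P *m (B *m B^T) = diag_mx l *m P & forall i, 0 <= l 0 i].
Proof.
have As : (B *m B^T)^T = B *m B^T by rewrite trmx_mul trmxK.
have [P [l [uP PA]]] := symmetric_diagonalizable As.
exists P, l; split => // i.
have v0 := row_unitmx_neq0 i uP; have := rayleigh_diag i PA.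
set v := (row i P)^T in v0 *.
have EE (w : 'cV_n) : w^T *m (B *m B^T) *m w = (B^T *m w)^T *m (B^T *m w).
  by rewrite trmx_mul trmxK !mulmxA.
rewrite /= -/v EE => E.
have := sqr_colvec_ge0 (B^T *m v); rewrite E pmulr_lge0//.
exact: sqr_colvec_gt0.
Qed.

(* A polynomial in [A] sending each eigenvalue to its fourth root gives a
   symmetric invertible [T]; then [T *m T] squares to [A], and it is positive
   definite because [T] is symmetric and invertible. *)
Lemma posdefmx_has_sqrt n (A : 'M[R]_n) : posdefmx A ->
  exists S : 'M[R]_n, posdefmx S /\ S *m S = A.
Proof.
case: n A => [|n] A pA.
  exists 0; split; last by apply/matrixP => -[].
  split=> [|v]; first by apply/matrixP => -[].
  by case/eqP; apply/matrixP => -[].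
have [P [l [uP PA l0]]] := posdefmx_diag pA.
have [p pE] := exists_interpolating_poly [seq l 0 i | i : 'I_n.+1]
  (fun x => Num.sqrt (Num.sqrt x)).
have plE i : p.[l 0 i] = Num.sqrt (Num.sqrt (l 0 i)).
  by apply: pE; apply/mapP; exists i; rewrite ?mem_enum.
pose T := horner_mx A p.
have Ts : T^T = T by apply: symmetric_horner_mx; case: pA.
have PX q : P *m horner_mx A q = diag_mx (map_mx (horner q) l) *m P.
  have -> : A = invmx P *m diag_mx l *m P by rewrite -mulmxA -PA mulKmx.
  by rewrite horner_mx_uconjC// horner_mx_diag !mulmxA mulmxV// mul1mx.
have uT : T \in unitmx.
  have : P *m T \in unitmx.
    rewrite PX unitmx_mul uP andbT unitmxE det_diag unitfE.
    by apply/prodf_neq0 => i _; rewrite mxE plE !sqrtr_eq0 -!ltNge sqrtr_gt0 l0.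
  by rewrite unitmx_mul => /andP[].
exists (T *m T); split; first split.
- by rewrite trmx_mul Ts.
- move=> v v0; rewrite mulmxA -{1}Ts -trmx_mul -mulmxA; apply: sqr_colvec_gt0.
  apply: contra v0 => /eqP Tv; apply/eqP.
  by rewrite -(mulKmx uT v) Tv mulmx0.
- have -> : T *m T *m (T *m T) = horner_mx A (p * p * (p * p)).
    by rewrite !rmorphM.
  apply: (can_inj (mulKmx uP)); rewrite PX PA; congr (diag_mx _ *m _).
  apply/rowP => i; rewrite mxE !hornerM plE -!expr2.
  by rewrite !sqr_sqrtr ?sqrtr_ge0// ltW.
Qed.

Lemma posdefmx_unit n (A : 'M[R]_n) : posdefmx A -> A \in unitmx.
Proof.
move=> /posdefmx_diag[P [l [uP PA l0]]].
have : P *m A \in unitmx.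
  rewrite PA unitmx_mul uP andbT unitmxE det_diag unitfE.
  by apply/prodf_neq0 => i _; rewrite gt_eqF.
by rewrite unitmx_mul => /andP[].
Qed.

Lemma sqrtmxP n (A : 'M[R]_n) : posdefmx A ->
  posdefmx (sqrtmx A) /\ sqrtmx A *m sqrtmx A = A.
Proof.
move=> /posdefmx_has_sqrt HS.
exact: (@xgetPex _ 0 [set S : 'M[R]_n | posdefmx S /\ S *m S = A] HS).
Qed.

Lemma posdefmx_det_gt0 n (A : 'M[R]_n) : posdefmx A -> 0 < \det A.
Proof.
move=> pA; have [pS SE] := sqrtmxP pA.
have := posdefmx_unit pS; rewrite unitmxE unitfE => d0.
by rewrite -SE det_mulmx -expr2 lt_neqAle sqr_ge0 andbT eq_sym sqrf_eq0.
Qed.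

Lemma invmx_sqrtmx n (A : 'M[R]_n) : posdefmx A ->
  invmx A = invsqrtmx A *m invsqrtmx A.
Proof.
move=> pA; have [pS SE] := sqrtmxP pA; have uS := posdefmx_unit pS.
have uA := posdefmx_unit pA.
apply: (can_inj (mulKmx uA)); rewrite mulmxV// /invsqrtmx -{1}SE.
by rewrite -mulmxA (mulmxA (sqrtmx A) (invmx _)) mulmxV// mul1mx mulmxV.
Qed.

Lemma trmx_invsqrtmx n (A : 'M[R]_n) :
  posdefmx A -> (invsqrtmx A)^T = invsqrtmx A.
Proof. by move=> /sqrtmxP[[St _] _]; rewrite /invsqrtmx trmx_inv St. Qed.

(** * Trace and determinant in terms of the eigenvalues of Delta Delta^T *)

Lemma DeltaDeltaTE d m (Sigma : 'M[R]_d) (Omega : 'M[R]_m) (X : 'M[R]_(d, m)) :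
  posdefmx Sigma -> posdefmx Omega ->
  DeltaDeltaT Sigma Omega X =
  invsqrtmx Sigma *m (X *m invmx Omega *m X^T) *m invsqrtmx Sigma.
Proof.
move=> pS pO; rewrite /DeltaDeltaT /Delta !trmx_mul !trmx_invsqrtmx//.
by rewrite invmx_sqrtmx// !mulmxA.
Qed.

Lemma mxtrace_DeltaDeltaT d m (Sigma : 'M[R]_d) (Omega : 'M[R]_m)
    (X : 'M[R]_(d, m)) :
  posdefmx Sigma -> posdefmx Omega ->
  \tr (invmx Sigma *m X *m invmx Omega *m X^T)
  = \tr (DeltaDeltaT Sigma Omega X).
Proof.
move=> pS pO; rewrite DeltaDeltaTE// [RHS]mxtrace_mulC invmx_sqrtmx//.
by rewrite !mulmxA.
Qed.

(** Conjugation by the square root [S] of [Sigma] carries one matrix to the other and preserves the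
    determinant. *)
Lemma det_DeltaDeltaT d m (Sigma : 'M[R]_d) (Omega : 'M[R]_m)
    (X : 'M[R]_(d, m)) t :
  posdefmx Sigma -> posdefmx Omega ->
  \det (1%:M + t *: (invmx Sigma *m X *m invmx Omega *m X^T))
  = \det (1%:M + t *: DeltaDeltaT Sigma Omega X).
Proof.
move=> pS pO; set S := sqrtmx Sigma; have [pS' SE] := sqrtmxP pS.
have uS : S \in unitmx by exact: posdefmx_unit.
have dS : \det S * \det (invmx S) = 1 by rewrite -det_mulmx mulmxV// det1.
rewrite -[LHS]mul1r -{1}dS mulrAC -!det_mulmx; congr (\det _).
rewrite DeltaDeltaTE// mulmxDr mulmx1 mulmxDl mulmxV//; congr (_ + _).
rewrite -scalemxAr -scalemxAl; congr (_ *: _).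
by rewrite invmx_sqrtmx// /invsqrtmx -/S -!mulmxA mulKVmx.
Qed.

(** Both quantities are similarity invariants and symmetric in the eigenvalues, so the entries of
    [l] may come in any order. *)
Lemma diag_similar_trace_det n (A P : 'M[R]_n) (l : 'rV[R]_n) : P \in unitmx ->
  P *m A = diag_mx l *m P ->
  (forall k, \tr (A ^+ k) = \sum_i l 0 i ^+ k) /\
  (forall t, \det (1%:M + t *: A) = \prod_i (1 + t * l 0 i)).
Proof.
move=> uP PA.
have AE : A = invmx P *m diag_mx l *m P by rewrite -mulmxA -PA mulKmx.
split=> [k|t].
  have Xk : P *m A ^+ k = diag_mx (map_mx (fun x => x ^+ k) l) *m P.
    elim: k => [|k IH].
      rewrite expr0 mulmx1 (_ : map_mx _ _ = const_mx 1).
        by rewrite diag_const_mx mul1mx.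
      by apply/rowP => i; rewrite !mxE expr0.
    rewrite exprSr mulmxA IH -mulmxA PA mulmxA mulmx_diag.
    congr (diag_mx _ *m _).
    by apply/rowP => i; rewrite !mxE exprSr.
  rewrite -[A ^+ k](mulKmx uP) Xk mxtrace_mulC mulmxK// mxtrace_diag.
  by apply: eq_bigr => i _; rewrite mxE.
have dP : \det P * \det (invmx P) = 1 by rewrite -det_mulmx mulmxV// det1.
rewrite -[LHS]mul1r -{1}dP mulrAC -!det_mulmx mulmxDr mulmx1 -scalemxAr PA.
rewrite mulmxDl mulmxV// -scalemxAl mulmxK//.
have -> : 1%:M + t *: diag_mx l = diag_mx (const_mx 1 + t *: l).
  by rewrite linearD linearZ /= diag_const_mx.
by rewrite det_diag; apply: eq_bigr => i _; rewrite !mxE.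
Qed.
End Diagonalization.

(** * The density ratio *)

Section LogRatio.
Context {R : realType}.
Implicit Types (nu : R).

Lemma sum_cst_addl d m (k : R) (f : 'I_d -> 'I_m -> R) :
  \sum_(j < d) \sum_(i < m) (k + f j i)
  = k * m%:R * d%:R + \sum_(j < d) \sum_(i < m) f j i.
Proof.
rewrite (eq_bigr (fun j => k * m%:R + \sum_(i < m) f j i)); last first.
  by move=> j _; rewrite big_split sumr_const card_ord; congr (_ + _);
    rewrite mulr_natr.
by rewrite big_split sumr_const card_ord; congr (_ + _); rewrite [RHS]mulr_natr.
Qed.

(** Here r = nu / (nu - 2), e = md/2, g is the ratio of multivariate gammas, q the determinant with
    exponent -p, b1 = nu pi, b2 = 2 pi, and t half the trace. The factors s and o from [Sigma] and
    [Omega] cancel. *)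
Lemma ln_density_ratio (r e g q p b1 b2 s o t : R) :
  0 < r -> 0 < g -> 0 < q -> 0 < b1 -> 0 < b2 -> 0 < s -> 0 < o ->
  ln (r `^ e * (g * (q `^ (- p) / (b1 `^ e * s * o)))
      / (expR (- t) / (b2 `^ e * s * o)))
  = e * ln r + ln g - p * ln q - e * ln b1 + t + e * ln b2.
Proof.
move=> r0 g0 q0 b10 b20 s0 o0.
have -> : r `^ e * (g * (q `^ (- p) / (b1 `^ e * s * o)))
      / (expR (- t) / (b2 `^ e * s * o))
  = r `^ e * g * q `^ (- p) / b1 `^ e * expR t * b2 `^ e.
  rewrite expRN; field.
  by rewrite !gt_eqF ?powR_gt0 ?expR_gt0.
rewrite !lnM ?posrE ?mulr_gt0 ?invr_gt0 ?powR_gt0 ?expR_gt0//.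
by rewrite lnV ?posrE ?powR_gt0// !ln_powR expRK; ring.
Qed.

Lemma mxtrace_scale_form d m (Sigma : 'M[R]_d) (Omega : 'M[R]_m)
    (X : 'M[R]_(d, m)) (c : R) :
  \tr (invmx Sigma *m (c *: X) *m invmx Omega *m (c *: X)^T)
  = c ^+ 2 * \tr (invmx Sigma *m X *m invmx Omega *m X^T).
Proof.
by rewrite [(c *: X)^T]linearZ /= -!scalemxAr -!scalemxAl scalerA mxtraceZ.
Qed.

Lemma log_ratio_density d m (Sigma : 'M[R]_d) (Omega : 'M[R]_m)
    (X : 'M[R]_(d, m)) (l : 'rV[R]_d) nu :
  posdefmx Sigma -> posdefmx Omega -> 4 <= nu ->
  (forall i, 0 <= l 0 i) ->
  \tr (DeltaDeltaT Sigma Omega X) = \sum_i l 0 i ->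
  (forall t, \det (1%:M + t *: DeltaDeltaT Sigma Omega X)
             = \prod_i (1 + t * l 0 i)) ->
  ln ((nu / (nu - 2)) `^ (m%:R * d%:R / 2) * matT_density nu Sigma Omega X
      / matN_density Sigma Omega ((Num.sqrt (nu / (nu - 2)))^-1 *: X))
  = \sum_(j < d) \sum_(i < m)
      (ln (nu / (nu - 2)) / 2 - ln (nu / 2) / 2
       + half_step (nu + (j%:R + i%:R)))
    + \sum_(j < d) ((nu - 2) / nu * l 0 j / 2
      - (nu + (m%:R + d%:R - 1)) / 2 * ln (1 + nu^-1 * l 0 j)).
Proof.
move=> pS pO nu4 l0 trD detD.
have nu0 : 0 < nu by apply: lt_le_trans nu4.
have nu2 : 0 < nu - 2 by rewrite subr_gt0 (lt_le_trans _ nu4)// ltr_nat.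
have r0 : 0 < nu / (nu - 2) by rewrite divr_gt0.
have f0 j : 0 < 1 + nu^-1 * l 0 j.
  by rewrite ltr_wpDr// mulr_ge0// invr_ge0 ltW.
rewrite /matT_density /matN_density mxtrace_scale_form mxtrace_DeltaDeltaT//.
rewrite det_DeltaDeltaT// detD trD.
have m0 : 0 <= m%:R :> R by [].
have d0 : 0 <= d%:R :> R by [].
have g0 : 0 < multiGamma d ((nu + m%:R + d%:R - 1) / 2)
    / multiGamma d ((nu + d%:R - 1) / 2).
  by apply: divr_gt0; apply: multiGamma_gt0; lra.
have q0 : 0 < \prod_(i < d) (1 + nu^-1 * l 0 i) by apply: prodr_gt0.
have b1 : 0 < nu * pi by rewrite mulr_gt0 ?pi_gt0.
have b2 : 0 < 2 * pi :> R by rewrite mulr_gt0 ?pi_gt0.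
rewrite ln_density_ratio ?powR_gt0 ?posdefmx_det_gt0//.
rewrite ln_multiGamma_ratio; last by lra.
rewrite ln_prod_gt0// {g0}.
(* keeps unification from unfolding the integral in [Gamma] *)
move: (@half_step R) => H.
(* The terms in 2 pi cancel, and (md/2) (ln r - ln (nu / 2)) is shared equally among the md gamma
   terms. *)
have -> : ln (nu * pi) = ln (nu / 2) + ln (2 * pi).
  rewrite -lnM ?posrE ?mulr_gt0 ?pi_gt0 ?invr_gt0//.
  by congr ln; field.
(* The rescaling of X in the normal density multiplies the trace by (nu - 2) / nu. *)
rewrite exprVn sqr_sqrtr ?(ltW r0)// invf_div.
rewrite sum_cst_addl sumrB -mulr_suml -!mulr_sumr.
by field; rewrite gt_eqF.
Qed.

Lemma sum_eigenvalue_poly (I : Type) (r : seq I) (f : I -> R) (a u : R) :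
  \sum_(i <- r) (u * (1 / 4 * f i ^+ 2 - (a + 2) / 2 * f i)
     + u ^+ 2 * (- (1 / 6 * f i ^+ 3) + a / 4 * f i ^+ 2)
     + u ^+ 3 * (1 / 8 * f i ^+ 4 - a / 6 * f i ^+ 3))
  = u * (1 / 4 * (\sum_(i <- r) f i ^+ 2) - (a + 2) / 2 * \sum_(i <- r) f i)
     + u ^+ 2 * (- (1 / 6 * \sum_(i <- r) f i ^+ 3)
                 + a / 4 * \sum_(i <- r) f i ^+ 2)
     + u ^+ 3 * (1 / 8 * (\sum_(i <- r) f i ^+ 4)
                 - a / 6 * \sum_(i <- r) f i ^+ 3).
Proof.
elim: r => [|i r IH]; first by rewrite !big_nil; ring.
by rewrite !big_cons IH; field.
Qed.

(** The limsup is an infimum over neighbourhoods of infinity of suprema; the half-line above [nu0]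
    is one of these neighbourhoods. *)
Lemma limsup_unif_le (T : Type) (B : R -> set T) (a b : R -> T -> R)
    (nu0 C : R) :
  (forall nu x, nu0 < nu -> `|a nu x / b nu x| <= C) ->
  (limsup_unif B a b <= C%:E)%E.
Proof.
move=> H; rewrite /limsup_unif limf_esupE; apply: ge_ereal_inf.
exists (ereal_sup [set ereal_sup [set (`|a nu x / b nu x|)%:E | x in B nu]
                  | nu in [set nu | nu0 < nu]]).
  by exists [set nu | nu0 < nu] => //; exists nu0; rewrite num_real.
apply: ge_ereal_sup => _ [nu /= nu0nu <-].
by apply: ge_ereal_sup => _ [x _ <-]; rewrite lee_fin H.
Qed.

End LogRatio.

Theorem theorem1 (R : realType) (d m : nat) (hd : (0 < d)%N) (hm : (0 < m)%N)
    (eta : R) (heta0 : 0 < eta) (heta1 : eta < 1) :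
  exists C : R, 0 < C /\
    forall (Sigma : 'M[R]_d) (Omega : 'M[R]_m),
      posdefmx Sigma -> posdefmx Omega ->
      let D (X : 'M[R]_(d, m)) : 'M[R]_d := DeltaDeltaT Sigma Omega X in
      let dr : R := d%:R in
      let mr : R := m%:R in
      let log_ratio (nu : R) (X : 'M[R]_(d, m)) : R :=
        ln ((nu / (nu - 2)) `^ (mr * dr / 2) * matT_density nu Sigma Omega X
            / matN_density Sigma Omega
                ((Num.sqrt (nu / (nu - 2)))^-1 *: X)) in
      let expansion (nu : R) (X : 'M[R]_(d, m)) : R :=
        nu ^- 1 * (1 / 4 * \tr (D X ^+ 2)
                   - (mr + dr + 1) / 2 * \tr (D X)
                   + mr * dr * (mr + dr + 1) / 4)
        + nu ^- 2 * (- (1 / 6 * \tr (D X ^+ 3))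
                     + (mr + dr - 1) / 4 * \tr (D X ^+ 2)
                     + mr * dr / 24
                       * (13 - 2 * dr ^+ 2 - 3 * dr * (- 3 + mr)
                          + 9 * mr - 2 * mr ^+ 2))
        + nu ^- 3 * (1 / 8 * \tr (D X ^+ 4)
                     - (mr + dr - 1) / 6 * \tr (D X ^+ 3)
                     + mr * dr / 24
                       * (26 + dr ^+ 3 + 2 * dr ^+ 2 * (- 3 + mr) + 11 * mr
                          - 6 * mr ^+ 2 + mr ^+ 3
                          + dr * (11 - 9 * mr + 2 * mr ^+ 2))) in
      let remainder (nu : R) (X : 'M[R]_(d, m)) : R :=
        log_ratio nu X - expansion nu X in
      let bound (nu : R) (X : 'M[R]_(d, m)) : R :=
        (1 + \tr (D X ^+ 5)) / nu ^+ 4 in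
      (limsup_unif (fun nu : R => bulk nu Sigma Omega eta) remainder bound
         < C%:E)%E.
Proof.
pose a : R := m%:R + d%:R - 1.
pose K : R := \sum_(j < d) \sum_(i < m) shift_const (j%:R + i%:R).
(* [K] collects the gamma errors; the other summand comes from the [d] eigenvalue errors. Both
   depend only on [d] and [m]. *)
pose C0 := K + (1 + a) * (d%:R + 1).
have d1 : 1 <= d%:R :> R by rewrite ler1n.
have m1 : 1 <= m%:R :> R by rewrite ler1n.
have a0 : 0 <= a by rewrite /a; lra.
have K0 : 0 <= K.
  apply: sumr_ge0 => j _; apply: sumr_ge0 => i _.
  by rewrite /shift_const !addr_ge0 ?mulr_ge0 ?exprn_ge0 ?addr_ge0.
have C00 : 0 <= C0 by apply: addr_ge0 => //; apply: mulr_ge0; lra.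
(* The added 1 makes the final inequality strict. *)
exists (C0 + 1); split; first lra.
move=> Sigma Omega pS pO; lazy zeta.
pose D X : 'M[R]_d := DeltaDeltaT Sigma Omega X.
apply: (@le_lt_trans _ _ C0%:E); last by rewrite lte_fin ltrDl.
(* The threshold 4 is the one required by [half_shift_expansion] and [log_ratio_density]. *)
apply: (@limsup_unif_le _ _ _ _ _ 4) => nu X /ltW nu4.
have [P [l [uP PD l0]]] := gram_diag (Delta Sigma Omega X).
have [trD detD] := diag_similar_trace_det uP PD.
have trD1 : \tr (D X) = \sum_i l 0 i.
  by rewrite -[D X]expr1 trD; apply: eq_bigr => i _; rewrite expr1.
have nu0 : 0 < nu by apply: lt_le_trans nu4.
have nu40 : 0 < nu ^+ 4 by rewrite exprn_gt0.
have tr5 : 0 <= \tr (D X ^+ 5).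
  by rewrite trD sumr_ge0// => i _; rewrite exprn_ge0.
rewrite -/(D X); have bound0 : 0 < (1 + \tr (D X ^+ 5)) / nu ^+ 4.
  by apply: divr_gt0 => //; apply: ltr_wpDr.
rewrite normrM normfV (gtr0_norm bound0) ler_pdivrMr//.
(* The remainder is regrouped as md gamma errors plus d eigenvalue errors, each with its own part of
   the expansion subtracted. *)
rewrite [X in `|X|](_ : _ =
    \sum_(j < d) \sum_(i < m)
      (ln (nu / (nu - 2)) / 2 - ln (nu / 2) / 2 + half_step (nu + (j%:R + i%:R))
       - shift_coef (j%:R + i%:R) nu^-1)
    + \sum_(j < d) ((nu - 2) / nu * l 0 j / 2
        - (nu + a) / 2 * ln (1 + nu^-1 * l 0 j)
      - (nu^-1 * (1 / 4 * l 0 j ^+ 2 - (a + 2) / 2 * l 0 j)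
       + nu^-1 ^+ 2 * (- (1 / 6 * l 0 j ^+ 3) + a / 4 * l 0 j ^+ 2)
       + nu^-1 ^+ 3 * (1 / 8 * l 0 j ^+ 4 - a / 6 * l 0 j ^+ 3)))); last first.
  rewrite (log_ratio_density pS pO nu4 l0 trD1 detD).
  rewrite trD1 !trD -/a.
  rewrite [X in _ = _ + X]sumrB sum_eigenvalue_poly.
  under [in RHS]eq_bigr do rewrite sumrB.
  rewrite [X in _ = X + _]sumrB sum_shift_coef /= /a -!exprVn.
  move: (\sum_(j < d) \sum_(i < m) _) (\sum_(j < d) (_ - _)) => s1 s2.
  by field; rewrite gt_eqF.
apply: (le_trans (ler_normD _ _)).
have B1 : `|\sum_(j < d) \sum_(i < m)
      (ln (nu / (nu - 2)) / 2 - ln (nu / 2) / 2 + half_step (nu + (j%:R + i%:R))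
       - shift_coef (j%:R + i%:R) nu^-1)| <= K / nu ^+ 4.
  rewrite /K mulr_suml (le_trans (ler_norm_sum _ _ _))//; apply: ler_sum => j _.
  rewrite mulr_suml (le_trans (ler_norm_sum _ _ _))//; apply: ler_sum => i _.
  have k0 : 0 <= j%:R + i%:R :> R by exact: addr_ge0.
  exact: (half_shift_expansion (@half_step_add R) (@half_step_le R) k0 nu4).
have B2 : `|\sum_(j < d) ((nu - 2) / nu * l 0 j / 2
        - (nu + a) / 2 * ln (1 + nu^-1 * l 0 j)
      - (nu^-1 * (1 / 4 * l 0 j ^+ 2 - (a + 2) / 2 * l 0 j)
       + nu^-1 ^+ 2 * (- (1 / 6 * l 0 j ^+ 3) + a / 4 * l 0 j ^+ 2)
       + nu^-1 ^+ 3 * (1 / 8 * l 0 j ^+ 4 - a / 6 * l 0 j ^+ 3)))|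
    <= (1 + a) * (d%:R + \tr (D X ^+ 5)) / nu ^+ 4.
  have -> : (1 + a) * (d%:R + \tr (D X ^+ 5)) / nu ^+ 4
      = \sum_(j < d) (1 + a) * (1 + l 0 j ^+ 5) / nu ^+ 4.
    by rewrite -mulr_suml -mulr_sumr big_split /= sumr_const card_ord trD.
  apply: (le_trans (ler_norm_sum _ _ _)); apply: ler_sum => j _.
  by apply: eigenvalue_term => //; lra.
apply: (le_trans (lerD B1 B2)).
rewrite mulrA -mulrDl ler_wpM2r ?invr_ge0 ?(ltW nu40)//.
(* Expanding [C0] times 1 + tr (D^5) leaves only nonnegative products beyond the sum of the two
   bounds. *)
have h1 : 0 <= K * \tr (D X ^+ 5) by rewrite mulr_ge0.
have h2 : 0 <= a * d%:R by rewrite mulr_ge0.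
have h3 : 0 <= a * \tr (D X ^+ 5) by rewrite mulr_ge0.
have h4 : 0 <= d%:R * \tr (D X ^+ 5) by rewrite mulr_ge0.
have h5 : 0 <= a * d%:R * \tr (D X ^+ 5) by rewrite !mulr_ge0.
rewrite /C0; lra.
Qed.
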